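(* Let $k$ be an algebraically closed field of characteristic $0$, $G=\mathbf{SL}_2$, and $V=R_{d_1}\oplus\dots\oplus R_{d_m}$ with $d_1,\dots,d_m\in\mathbb Z_+$. Then $\mathrm{pol\,ind}(V)=1$ if $d_i=1$ for some $i$, and $\mathrm{pol\,ind}(V)=\infty$ otherwise.
   Context: $R_d$ is the $\mathbf{SL}_2$-module of binary forms of degree $d$ in $x,y$. For $n\in\mathbb N$, $G$ acts diagonally on $V^{\oplus n}$. Polarizations of $f\in k[V]$: $f(\alpha_1v_1+\dots+\alpha_nv_n)=\sum_{(i_1,\dots,i_n)\in\mathbb Z_+^n}\alpha_1^{i_1}\cdots\alpha_n^{i_n}f_{i_1,\dots,i_n}(v_1,\dots,v_n)$; $\mathrm{pol}_nk[V]^G\subseteq k[V^{\oplus n}]^G$ is generated by polarizations of all $f\in k[V]^G$. $\mathcal N_{V^{\oplus n},G}=\{w:F(w)=F(0)\ \forall F\in k[V^{\oplus n}]^G\}$, $\mathcal P_{V^{\oplus n},G}=\{w:h(w)=h(0)\ \forall h\in\mathrm{pol}_nk[V]^G\}$. The polarization index $\mathrm{pol\,ind}(V)$ is the supremum of all $n\in\mathbb N$ with $\mathcal N_{V^{\oplus n},G}=\mathcal P_{V^{\oplus n},G}$. *)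

(* Defs.v *)
From HB Require Import structures.
From mathcomp Require Import all_boot all_order all_algebra.
From mathcomp Require Import mpoly.
Set Implicit Arguments. Unset Strict Implicit. Unset Printing Implicit Defensive.
Import Order.TTheory GRing.Theory Num.Theory.
Local Open Scope ring_scope.

(* Binary forms.  A binary form of degree d,                               *)
(*    f = \sum_(j <= d) a_j x^(d-j) y^j,                                   *)
(* is represented by its coefficient row vector a : 'rV_(d.+1).           *)
(* g = [[a,b],[c,e]] in SL_2 acts (on the right) by                        *)
(*    (f . g)(x,y) = f(a x + b y, c x + e y).                              *)
(* Dehomogenizing at x = 1, y = t, the coefficient of x^(d-l) y^l of f.g   *)
(* is the coefficient of t^l in \sum_j a_j (a + b t)^(d-j) (c + e t)^j.    *)
(* rho d g is the matrix of this action on coefficient row vectors.        *)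
Definition rho (k : fieldType) (d : nat) (g : 'M[k]_2) : 'M[k]_(d.+1) :=
  \matrix_(j < d.+1, l < d.+1)
    (((g 0 0)%:P + (g 0 1) *: 'X) ^+ (d - j) *
     ((g 1 0)%:P + (g 1 1) *: 'X) ^+ j)`_l.

Definition SL2 (k : fieldType) (g : 'M[k]_2) : Prop := \det g = 1.

Definition dimV (m : nat) (d : 'I_m -> nat) : nat := \sum_(i < m) (d i).+1.

Definition rhoV (k : fieldType) (m : nat) (d : 'I_m -> nat) (g : 'M[k]_2)
  : 'M[k]_(dimV d) :=
  \mxdiag_(i < m) rho (d i) g.

Definition invariant (k : fieldType) (m : nat) (d : 'I_m -> nat)
  (f : {mpoly k[dimV d]}) : Prop :=
  forall (g : 'M[k]_2) (v : 'rV[k]_(dimV d)), SL2 g ->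
    f.@[fun j => (v *m rhoV d g) 0 j] = f.@[fun j => v 0 j].

(* V^{(+)n}: a point is a matrix w : 'M_(n, dimV d) whose i-th row is v_i.  *)
(* k[V^{(+)n}] = {mpoly k[n * dimV d]}, the variable mxvec_index i j being *)
(* the j-th coordinate of v_i.                                             *)
Definition evalVn (k : fieldType) (m : nat) (d : 'I_m -> nat) (n : nat)
  (F : {mpoly k[n * dimV d]}) (w : 'M[k]_(n, dimV d)) : k :=
  F.@[fun t => (mxvec w) 0 t].

Definition invariantn (k : fieldType) (m : nat) (d : 'I_m -> nat) (n : nat)
  (F : {mpoly k[n * dimV d]}) : Prop :=
  forall (g : 'M[k]_2) (w : 'M[k]_(n, dimV d)), SL2 g ->
    evalVn F (w *m rhoV d g) = evalVn F w.

(* f(alpha_1 v_1 + ... + alpha_n v_n), as a polynomial in alpha_1..alpha_n *)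
(* with coefficients in k[V^{(+)n}].                                       *)
Definition polarize_all (k : fieldType) (m : nat) (d : 'I_m -> nat) (n : nat)
  (f : {mpoly k[dimV d]}) : {mpoly {mpoly k[n * dimV d]}[n]} :=
  mmap (fun c : k => (c%:MP)%:MP)
       (fun j : 'I_(dimV d) =>
          \sum_(i < n) 'X_i * ('X_(mxvec_index i j))%:MP) f.

Definition polarization (k : fieldType) (m : nat) (d : 'I_m -> nat) (n : nat)
  (f : {mpoly k[dimV d]}) (mu : 'X_{1..n}) : {mpoly k[n * dimV d]} :=
  (@polarize_all k m d n f)@_mu.

Inductive pol_alg (k : fieldType) (m : nat) (d : 'I_m -> nat) (n : nat)
  : {mpoly k[n * dimV d]} -> Prop :=
| pol_alg_gen (f : {mpoly k[dimV d]}) (mu : 'X_{1..n}) :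
    invariant f -> pol_alg (@polarization k m d n f mu)
| pol_alg_cst (c : k) : pol_alg c%:MP
| pol_alg_add p q : pol_alg p -> pol_alg q -> pol_alg (p + q)
| pol_alg_mul p q : pol_alg p -> pol_alg q -> pol_alg (p * q).

Definition nullcone (k : fieldType) (m : nat) (d : 'I_m -> nat) (n : nat)
  (w : 'M[k]_(n, dimV d)) : Prop :=
  forall F : {mpoly k[n * dimV d]}, @invariantn k m d n F -> evalVn F w = evalVn F 0.

Definition polcone (k : fieldType) (m : nat) (d : 'I_m -> nat) (n : nat)
  (w : 'M[k]_(n, dimV d)) : Prop :=
  forall h : {mpoly k[n * dimV d]}, @pol_alg k m d n h -> evalVn h w = evalVn h 0.

Definition cones_agree (k : fieldType) (m : nat) (d : 'I_m -> nat) (n : nat)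
  : Prop :=
  forall w : 'M[k]_(n, dimV d), @nullcone k m d n w <-> @polcone k m d n w.

(* pol ind(V) = x, where x : option nat (None = infinity), with pol ind(V) *)
(* the supremum in N u {oo} of the set {n | cones_agree n}.               *)
Definition pol_ind_is (k : fieldType) (m : nat) (d : 'I_m -> nat)
  (x : option nat) : Prop :=
  match x with
  | Some p => (forall n, @cones_agree k m d n -> (n <= p)%N) /\
              (forall q, (forall n, @cones_agree k m d n -> (n <= q)%N) ->
                         (p <= q)%N)
  | None => forall q, ~ (forall n, @cones_agree k m d n -> (n <= q)%N)
  end.

(* Main.v *)
(** Call a form of degree d nilpotent at a point q of P^1 if q is a root of
    multiplicity greater than d/2.

    Hilbert-Mumford for SL_2 on V is proved through explicit invariants. If the
    nonzero components of v are not all nilpotent at a common point, some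
    product f_i^a f_j^b (i = j allowed) is semistable; squaring it gives a form
    l_1 ... l_(2e) of degree 2e, no root of which has multiplicity more than e.
    The linear factors can then be paired so that l_i and l_(e+i) are never
    proportional. The sum over all permutations s of
    (prod_i [l_s(i), l_s(e+i)])^N is SL_2-invariant, nonzero for some N > 0,
    and polynomial in the coefficients of the product: it expands into
    permanents, and Ryser's formula writes these as combinations of products
    prod_t h(l_t), each of which is a product of values of the form at the
    zeros of h.

    A point of the polarization cone is a tuple all of whose linear combinations
    are nilpotent. If no degree is 1, a multiple root of a + t b is a zero of
    the Wronskian of a and b, so two members of the pencil share their point,
    which is then common to a and b; hence the whole tuple is nilpotent at one
    point, and a one-parameter subgroup contracts it to 0. If some degree is 1,
    two independent linear forms have only nilpotent combinations, but their
    bracket is an invariant which does not vanish. *)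
Require Import Defs.
From HB Require Import structures.
From mathcomp Require Import all_boot all_order all_fingroup all_algebra.
From mathcomp Require Import mpoly zify ring.
Set Implicit Arguments. Unset Strict Implicit. Unset Printing Implicit Defensive.
Import GRing.Theory.
Local Open Scope ring_scope.

(* The binary form of degree d which dehomogenizes to p, evaluated at (x, y). *)
Definition hev (R : comNzRingType) (d : nat) (p : {poly R}) (x y : R) : R :=
  \sum_(j < d.+1) p`_j * (x ^+ (d - j) * y ^+ j).

(** * Binary forms through their dehomogenizations *)

Section HomogeneousEvaluation.
Variable R : comNzRingType.
Implicit Types (p q : {poly R}) (x y c : R) (u : R * R).

Lemma hevD d p q x y : hev d (p + q) x y = hev d p x y + hev d q x y.
Proof. by rewrite /hev -big_split /=; apply: eq_bigr => j _; rewrite coefD mulrDl. Qed.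

Lemma hevZ d c p x y : hev d (c *: p) x y = c * hev d p x y.
Proof. by rewrite /hev mulr_sumr; apply: eq_bigr => j _; rewrite coefZ -mulrA. Qed.

Lemma hev0 d x y : hev d 0 x y = 0.
Proof. by rewrite /hev big1 // => j _; rewrite coef0 mul0r. Qed.

Lemma hev_sum (I : Type) (r : seq I) (P : pred I) (F : I -> {poly R}) d x y :
  hev d (\sum_(i <- r | P i) F i) x y = \sum_(i <- r | P i) hev d (F i) x y.
Proof.
exact: (big_morph (fun p => hev d p x y) (fun p q => hevD d p q x y) (hev0 d x y)).
Qed.

Lemma hevXn d n x y : (n <= d)%N -> hev d 'X^n x y = x ^+ (d - n) * y ^+ n.
Proof.
move=> le_nd; have lt_nd : (n < d.+1)%N by [].
rewrite /hev (bigD1 (Ordinal lt_nd)) //= coefXn eqxx mul1r big1 ?addr0 // => j.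
by rewrite -val_eqE /= coefXn => /negPf->; rewrite mul0r.
Qed.

Lemma poly_sumE d p : (size p <= d.+1)%N -> p = \sum_(j < d.+1) p`_j *: 'X^j.
Proof.
move=> sp; rewrite -poly_def; apply/polyP => i; rewrite coef_poly.
by case: ltnP => // di; rewrite nth_default // (leq_trans sp).
Qed.

(** By bilinearity monomials suffice. The size bounds matter, since [hev] drops the coefficients
    beyond its degree. *)
Lemma hevM d e p q x y : (size p <= d.+1)%N -> (size q <= e.+1)%N ->
  hev (d + e) (p * q) x y = hev d p x y * hev e q x y.
Proof.
move=> sp sq; rewrite [p in LHS](poly_sumE sp) [q in LHS](poly_sumE sq).
rewrite mulr_suml hev_sum [RHS]mulr_suml; apply: eq_bigr => i _.
rewrite mulr_sumr hev_sum [RHS]mulr_sumr; apply: eq_bigr => j _.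
have [ltid ltje] := (ltn_ord i, ltn_ord j).
rewrite -scalerAl -scalerAr -exprD !hevZ hevXn; last by lia.
have -> : (d + e - (i + j) = (d - i) + (e - j))%N by lia.
by rewrite !exprD; ring.
Qed.

Lemma size_hexp d n p : (size p <= d.+1)%N -> (size (p ^+ n) <= (n * d).+1)%N.
Proof.
move=> sp; apply: leq_trans (size_poly_exp_leq _ _) _; rewrite ltnS mulnC leq_mul2l.
by apply/orP; right; lia.
Qed.

Lemma hevX d n p x y : (size p <= d.+1)%N ->
  hev (n * d) (p ^+ n) x y = hev d p x y ^+ n.
Proof.
move=> sp; elim: n => [|n IHn]; first by rewrite mul0n !expr0 (hevXn (n := 0)) // !mulr1.
by rewrite !exprS mulSn hevM ?size_hexp ?IHn.
Qed.

Definition lform u : {poly R} := u.1%:P + u.2 *: 'X.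

Lemma size_lform u : (size (lform u) <= 2)%N.
Proof.
apply: leq_trans (size_polyD _ _) _; rewrite geq_max (leq_trans (size_polyC_leq1 _)) //.
by rewrite (leq_trans (size_scale_leq _ _)) // size_polyX.
Qed.

Lemma hev_lform u x y : hev 1 (lform u) x y = u.1 * x + u.2 * y.
Proof.
rewrite /hev !big_ord_recl big_ord0 /= /lform !coefD !coefZ !coefC !coefX /=.
by rewrite addr0 subn0 /=; ring.
Qed.

Lemma size_prod_lform (I : Type) (r : seq I) (l : I -> R * R) :
  (size (\prod_(i <- r) lform (l i))%R <= (size r).+1)%N.
Proof.
elim: r => [|i r IHr]; first by rewrite big_nil size_poly1.
rewrite big_cons (leq_trans (size_polyMleq _ _)) //=.
by have := size_lform (l i); move: IHr; set a := size (polyseq _); set b := size (polyseq _); lia.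
Qed.

Lemma hev_prod_lform (I : Type) (r : seq I) (l : I -> R * R) x y :
  hev (size r) (\prod_(i <- r) lform (l i)) x y
  = \prod_(i <- r) ((l i).1 * x + (l i).2 * y).
Proof.
elim: r => [|i r IHr]; first by rewrite !big_nil (hevXn (n := 0)) // !mulr1.
by rewrite !big_cons (hevM (d := 1%N)) ?(size_lform, size_prod_lform, hev_lform, IHr).
Qed.

End HomogeneousEvaluation.

(** * The action on forms and the bracket of linear forms *)

Definition actf (k : comNzRingType) (d : nat) (g : 'M[k]_2) (p : {poly k}) : {poly k} :=
  hev d (map_poly polyC p) (lform (g 0 0, g 0 1)) (lform (g 1 0, g 1 1)).

Section Action.
Variable k : fieldType.
Implicit Types (p q : {poly k}) (g : 'M[k]_2).

Lemma actfE d g p : actf d g p =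
  \sum_(j < d.+1) p`_j *: (lform (g 0 0, g 0 1) ^+ (d - j) * lform (g 1 0, g 1 1) ^+ j).
Proof. by rewrite /actf /hev; apply: eq_bigr => j _; rewrite coef_map mul_polyC. Qed.

(** The action evaluates a form over [{poly k}] at two linear forms, so [hevM] applies. *)
Lemma actfM d e g p q : (size p <= d.+1)%N -> (size q <= e.+1)%N ->
  actf (d + e) g (p * q) = actf d g p * actf e g q.
Proof. by move=> sp sq; rewrite /actf rmorphM hevM ?size_map_polyC. Qed.

Lemma actfX d n g p : (size p <= d.+1)%N ->
  actf (n * d) g (p ^+ n) = actf d g p ^+ n.
Proof. by move=> sp; rewrite /actf rmorphXn hevX ?size_map_polyC. Qed.

Definition lact g (u : k * k) : k * k :=
  (u.1 * g 0 0 + u.2 * g 1 0, u.1 * g 0 1 + u.2 * g 1 1).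

Lemma map_lform u : map_poly polyC (lform u) = lform (R := {poly k}) (u.1%:P, u.2%:P).
Proof. by rewrite /lform rmorphD /= map_polyC map_polyZ map_polyX. Qed.

Lemma lform_lact g u : lform (lact g u) =
  u.1%:P * lform (g 0 0, g 0 1) + u.2%:P * lform (g 1 0, g 1 1).
Proof.
by rewrite /lform /lact /= !polyCD !polyCM -!mul_polyC !polyCD !polyCM; ring.
Qed.

Lemma actf_prod_lform (I : Type) (r : seq I) (l : I -> k * k) g :
  actf (size r) g (\prod_(i <- r) lform (l i)) = \prod_(i <- r) lform (lact g (l i)).
Proof.
rewrite /actf rmorph_prod.
under eq_bigr do rewrite /= map_lform.
rewrite hev_prod_lform; apply: eq_bigr => i _ /=.
by rewrite lform_lact.
Qed.

Lemma actf_lform g u : actf 1 g (lform u) = lform (lact g u).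
Proof. by rewrite /actf map_lform hev_lform lform_lact. Qed.

Lemma size_actf d g p : (size (actf d g p) <= d.+1)%N.
Proof.
rewrite actfE (leq_trans (size_sum _ _ _)) //; apply/bigmax_leqP => j _.
rewrite (leq_trans (size_scale_leq _ _)) // (leq_trans (size_polyMleq _ _)) //.
have := size_hexp (d - j) (size_lform (g 0 0, g 0 1)).
have := size_hexp j (size_lform (g 1 0, g 1 1)).
have := ltn_ord j.
set a := size _; set b := size _; lia.
Qed.

Definition br (u v : k * k) : k := u.1 * v.2 - u.2 * v.1.

Lemma det_mx22 g : \det g = g 0 0 * g 1 1 - g 0 1 * g 1 0.
Proof.
have l00 : lift 0 0 = 1 :> 'I_2 by apply/val_inj.
have l10 : lift 1 0 = 0 :> 'I_2 by apply/val_inj.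
rewrite (expand_det_row g 0) big_ord_recl big_ord1 /cofactor !det_mx11 !mxE /= l00.
by rewrite l10 expr0 expr1 mul1r mulN1r mulrN.
Qed.

Lemma br_lact g u v : br (lact g u) (lact g v) = \det g * br u v.
Proof.
rewrite det_mx22 /br /lact /=; ring.
Qed.

End Action.

(** * Permanents *)

Lemma prod_natr_bool (R : comNzRingType) (T : finType) (b : pred T) :
  \prod_t ((b t)%:R : R) = [forall t, b t]%:R.
Proof.
case: (boolP [forall t, b t]) => [/forallP hb|]; first by rewrite big1 // => t _; rewrite hb.
rewrite negb_forall => /existsP[t /negPf ht].
by rewrite (bigD1 t) //= ht mul0r.
Qed.

(* Ryser's formula for the permanent: inclusion-exclusion over the set S of
   labels singles out the surjective maps. *)
Lemma permanent_ryser (R : comNzRingType) (T : finType) (y : T -> T -> R) :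
  \sum_(s : {perm T}) \prod_t y t (s t) =
  \sum_(S : {ffun T -> bool})
    (\prod_t (-1) ^+ (~~ S t)) * \prod_t \sum_u (S u)%:R * y t u.
Proof.
transitivity (\sum_(f : {ffun T -> T} | [forall t, t \in codom f]) \prod_t y t (f t)).
  rewrite (reindex (fun s : {perm T} => pval s)) /=; last first.
    have inj_of (f : {ffun T -> T}) : [forall t, t \in codom f] -> injectiveb f.
      move/forallP => sf; apply/card_uniqP; rewrite size_map -cardE.
      by apply: eq_card => t; rewrite [LHS]sf.
    exists (fun f => insubd (1%g : {perm T}) f) => [s _|f] /=.
      by apply: val_inj; rewrite /= insubdK //; apply: (valP s).
    by rewrite inE => /inj_of fi; rewrite /= -[pval _]/(val _) insubdK.
  apply: eq_big => s; last by move=> _; apply: eq_bigr => t _; rewrite pvalE.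
  apply/esym/forallP => t; rewrite -(permKV s t) -[pval s]/(val s).
  by rewrite -pvalE codom_f.
under [RHS]eq_bigr => S _ do rewrite bigA_distr_bigA big_distrr /=.
rewrite exchange_big /= big_mkcond; apply: eq_bigr => f _ /=.
transitivity ([forall t, t \in codom f]%:R * \prod_t y t (f t)).
  by case: ifP => _; rewrite ?mul1r ?mul0r.
under [RHS]eq_bigr => S _ do rewrite big_split /= mulrA.
rewrite -big_distrl /=; congr (_ * _).
(* The inner sum is 1 if [t] is a value of [f], and 1 - 1 = 0 otherwise; expanding the product over
   [t] creates the sum over [S]. *)
transitivity (\prod_t \sum_(b : bool) ((-1) ^+ (~~ b) * ((t \in codom f) ==> b)%:R : R)).
  rewrite -prod_natr_bool; apply: eq_bigr => t _; rewrite big_bool /=.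
  rewrite implybT implybF expr0 expr1 mul1r.
  by case: (t \in _); rewrite /= ?mulr0 ?addr0 ?mulr1 ?subrr.
rewrite bigA_distr_bigA; apply: eq_bigr => S _; rewrite big_split /=; congr (_ * _).
rewrite !prod_natr_bool; congr (nat_of_bool _)%:R.
apply/forallP/forallP => h t; first exact: (implyP (h (f t)) (codom_f f t)).
by apply/implyP => /codomP[u ->]; apply: h.
Qed.

(* Points of P^1, None being infinity: [point q] is the linear form 'X - r or 1
   vanishing at q. *)
Definition point (k : nzRingType) (q : option k) : k * k :=
  if q is Some r then (- r, 1) else (1, 0).

Definition scalep (k : nzRingType) (c : k) (u : k * k) : k * k := (c * u.1, c * u.2).

(** * Splitting of forms into linear factors *)

Section Factorization.
Variable k : closedFieldType.
Implicit Types (p : {poly k}) (q : option k).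

Lemma lform_scalep (c : k) u : lform (scalep c u) = c *: lform u.
Proof. by rewrite /lform /scalep /= scalerDr scalerA -mul_polyC polyCM mul_polyC. Qed.

Lemma lform_None : lform (point None) = 1 :> {poly k}.
Proof. by rewrite /lform /= scale0r addr0. Qed.

Lemma lform_Some (r : k) : lform (point (Some r)) = 'X - r%:P.
Proof. by rewrite /lform /= scale1r polyCN addrC. Qed.

Lemma br_point_neq0 q q' : q != q' -> br (point q) (point q') != 0.
Proof.
rewrite /br; case: q q' => [r|] [r'|] //= neq;
  rewrite ?(mul0r, mul1r, mulr1, mulr0, subr0, sub0r) ?oppr_eq0 ?oner_eq0 //.
by rewrite opprK addrC subr_eq0; apply: contra_neq neq => ->.
Qed.

(** The roots of the polynomial are the finite points; infinity, whose linear form dehomogenizes to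
    1, fills the list up to length [D]. *)
Lemma form_factor D p : (size p <= D.+1)%N -> p != 0 ->
  exists2 c, c != 0 & exists2 s : seq (option k), size s = D &
    p = c *: \prod_(q <- s) lform (point q).
Proof.
move=> sp p0; have [r Dp] := closed_field_poly_normal p.
exists (lead_coef p); first by rewrite lead_coef_eq0.
have sr : (size r <= D)%N.
  by move: sp; rewrite Dp size_scale ?lead_coef_eq0 // size_prod_XsubC.
exists (map Some r ++ nseq (D - size r) None).
  by rewrite size_cat size_map size_nseq subnKC.
rewrite big_cat big_map /= [X in _ * X]big1_seq ?mulr1.
  by rewrite [LHS]Dp; congr (_ *: _); apply: eq_bigr => z _; rewrite lform_Some.
by move=> q /andP[_ /nseqP[-> _]]; rewrite lform_None.
Qed.

Lemma exists_root n (c : k) : (0 < n)%N -> exists x, x ^+ n = c.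
Proof.
move=> n0; have [x hx] := solve_monicpoly (fun i => if i == 0%N then c else 0) n0.
exists x; rewrite hx; case: n n0 {hx} => // n _.
by rewrite big_ord_recl /= expr0 mulr1 big1 ?addr0 // => i _; rewrite mul0r.
Qed.

Lemma prod_lform_scalep (I : Type) (r : seq I) (l : I -> k * k) c :
  \prod_(i <- r) lform (scalep c (l i)) = c ^+ size r *: \prod_(i <- r) lform (l i).
Proof.
elim: r => [|i r IHr]; first by rewrite !big_nil scale1r.
by rewrite !big_cons IHr lform_scalep -scalerAl -scalerAr scalerA exprS.
Qed.

(** As [0 < D], the constant can be spread over the factors as a [D]-th root, and the zero form is a
    product of zero linear forms. *)
Lemma form_split D p : (0 < D)%N -> (size p <= D.+1)%N ->
  exists2 s : seq (k * k), size s = D & p = \prod_(u <- s) lform u.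
Proof.
move=> D0 sp; have [->|p0] := eqVneq p 0.
  exists (nseq D (0, 0)); first by rewrite size_nseq.
  case: D D0 {sp} => // D _; rewrite big_cons.
  by rewrite /lform /= scale0r addr0 mul0r.
have [c c0 [s ss ->]] := form_factor sp p0.
have [x Dx] := exists_root c D0.
exists (map (scalep x) (map (@point k) s)); first by rewrite !size_map.
by rewrite !big_map prod_lform_scalep ss Dx.
Qed.

End Factorization.

(** * Functions of linear forms that are polynomial in their product *)

Definition evpoly (k : comNzRingType) (D : nat) (L : seq (k * seq (k * k))) (p : {poly k}) : k :=
  \sum_(c <- L) c.1 * \prod_(u <- c.2) hev D p u.1 u.2.

(* The functions of D = #|T| linear forms which are polynomial in the
   coefficients of their product. *)
Definition symfun (k : comNzRingType) (T : finType) (F : (T -> k * k) -> k) : Prop :=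
  exists L, forall l, evpoly #|T| L (\prod_t lform (l t)) = F l.

Section SymmetricFunctions.
Variables (k : closedFieldType) (T : finType).
Implicit Types (F : (T -> k * k) -> k) (l : T -> k * k).

Lemma eq_symfun F F' : F =1 F' -> symfun F -> symfun F'.
Proof. by move=> eqF [L HL]; exists L => l; rewrite HL. Qed.

Lemma symfun_sum (I : Type) (r : seq I) (c : I -> k) (F : I -> (T -> k * k) -> k) :
  (forall i, symfun (F i)) -> symfun (fun l => \sum_(i <- r) c i * F i l).
Proof.
move=> HF; elim: r => [|i r [L HL]].
  by exists [::] => l; rewrite /evpoly !big_nil.
have [Li HLi] := HF i.
exists ([seq (c i * a.1, a.2) | a <- Li] ++ L) => l.
rewrite big_cons -HL -HLi /evpoly big_cat big_map mulr_sumr; congr (_ + _).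
by apply: eq_bigr => a _; rewrite mulrA.
Qed.

Lemma hev_prod_lform_fin l x y :
  hev #|T| (\prod_t lform (l t)) x y = \prod_t ((l t).1 * x + (l t).2 * y).
Proof. by rewrite -!big_enum cardE hev_prod_lform. Qed.

(** This is a resultant: with [h] a product of linear forms [u], the double product of the values of
    [u] at [l t] regroups into the values at the [u] of the form with factors [l t]. *)
Lemma symfun_prod_hev N (h : {poly k}) : (0 < N)%N -> (size h <= N.+1)%N ->
  symfun (fun l => \prod_(t : T) hev N h (l t).1 (l t).2).
Proof.
move=> N0 sh; have [s ss ->] := form_split N0 sh.
exists [:: (1, s)] => l; rewrite /evpoly big_seq1 mul1r /=.
under eq_bigr => u _ do rewrite hev_prod_lform_fin.
rewrite exchange_big /=; apply: eq_bigr => t _; rewrite -ss hev_prod_lform.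
by apply: eq_bigr => u _; rewrite mulrC [X in _ + X]mulrC.
Qed.

(** [permanent_ryser] turns the permanent into a combination of the products [F S], which
    [symfun_prod_hev] covers. *)
Lemma symfun_permanent N (h : T -> {poly k}) :
  (0 < N)%N -> (forall t, (size (h t) <= N.+1)%N) ->
  symfun (fun l => \sum_(s : {perm T}) \prod_t hev N (h t) (l (s t)).1 (l (s t)).2).
Proof.
move=> N0 sh.
pose F (S : {ffun T -> bool}) l :=
  \prod_(t : T) hev N (\sum_u (S u)%:R *: h u) (l t).1 (l t).2.
have HF S : symfun (F S).
  apply: symfun_prod_hev => //; rewrite (leq_trans (size_sum _ _ _)) //.
  by apply/bigmax_leqP => u _; rewrite (leq_trans (size_scale_leq _ _)).
have HS := symfun_sum (index_enum _) 
  (fun S : {ffun T -> bool} => \prod_t (-1) ^+ (~~ S t)) HF.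
apply: eq_symfun HS => l.
transitivity (\sum_(s : {perm T}) \prod_t hev N (h (s t)) (l t).1 (l t).2).
  rewrite (permanent_ryser (fun t u => hev N (h u) (l t).1 (l t).2)); apply: eq_bigr => S _; congr (_ * _).
  apply: eq_bigr => t _; rewrite hev_sum.
  by apply: eq_bigr => u _; rewrite hevZ.
(* Inverting [s] and then replacing [t] by [s t] moves the permutation from [h] to [l]. *)
rewrite (reindex_inj invg_inj); apply: eq_bigr => s _ /=.
rewrite (reindex_inj (@perm_inj _ s)) /=; apply: eq_bigr => t _.
by rewrite permK.
Qed.

End SymmetricFunctions.

(** * Bracket monomials symmetrized over all pairings *)

Lemma br_expn (k : fieldType) N (u v : k * k) : br u v ^+ N =
  \sum_(c < N.+1) (-1) ^+ c *+ 'C(N, c) *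
     (hev N 'X^c u.1 u.2 * hev N 'X^(N - c) v.1 v.2).
Proof.
rewrite /br exprBn; apply: eq_bigr => c _; have ltcN := ltn_ord c.
rewrite !hevXn ?leq_subr // subKn // !exprMn mulrnAl; congr (_ *+ _).
by ring.
Qed.

Definition matching_sum (k : fieldType) (e N : nat) (l : 'I_e * bool -> k * k) : k :=
  \sum_(s : {perm 'I_e * bool}) (\prod_(i < e) br (l (s (i, true))) (l (s (i, false)))) ^+ N.

(** Expanding by [br_expn] and choosing a term [c i] for every pair makes the summand a product over
    all labels; for fixed [c], the sum over [s] is the permanent [F c]. *)
Lemma symfun_matching_sum (k : closedFieldType) e N : (0 < N)%N ->
  symfun (@matching_sum k e N).
Proof.
move=> N0.
pose h (c : {ffun 'I_e -> 'I_N.+1}) (t : 'I_e * bool) : {poly k} :=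
  'X^(if t.2 then val (c t.1) else N - c t.1)%N.
pose F c l := \sum_(s : {perm 'I_e * bool}) \prod_t hev N (h c t) (l (s t)).1 (l (s t)).2.
have HF c : symfun (F c).
  apply: symfun_permanent => // t; rewrite size_polyXn ltnS; case: ifP => _.
    by rewrite -ltnS ltn_ord.
  by rewrite leq_subr.
apply: (eq_symfun _ (symfun_sum (index_enum _)
  (fun c : {ffun 'I_e -> 'I_N.+1} => \prod_i ((-1) ^+ c i *+ 'C(N, c i))) HF)) => l.
under eq_bigr => c _ do rewrite mulr_sumr.
rewrite exchange_big; apply: eq_bigr => s _ /=.
rewrite -prodrXl; under [RHS]eq_bigr => i _ do rewrite br_expn.
rewrite bigA_distr_bigA; apply: eq_bigr => c _ /=.
rewrite big_split /=; congr (_ * _).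
pose G t := hev N (h c t) (l (s t)).1 (l (s t)).2.
transitivity (\prod_i \prod_(b : bool) G (i, b)).
  by rewrite pair_bigA; apply: eq_bigr => -[i b].
by apply: eq_bigr => i _; rewrite big_bool.
Qed.

(** * Power sums in characteristic 0 *)

Lemma char0_natr_eq0 (k : fieldType) : [pchar k] =i pred0 ->
  forall n, ((n%:R : k) == 0) = (n == 0%N).
Proof. by move=> hk; apply/pcharf0P. Qed.

(** [q] vanishes at 0 and at all values other than [x i0]. If the positive power sums up to its
    degree were 0, so would be the sum of the [q.[x i]], which is [q.[x i0]] times the positive
    number of [i] with [x i = x i0]. *)
Lemma power_sum_neq0 (k : fieldType) (I : finType) (x : I -> k) i0 :
  [pchar k] =i pred0 -> x i0 != 0 ->
  exists2 N, (0 < N)%N & \sum_i x i ^+ N != 0.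
Proof.
move=> hk x0.
pose q := 'X * \prod_(i | x i != x i0) ('X - (x i)%:P).
case: (pickP (fun j : 'I_(size q) => (0 < j)%N && (\sum_i x i ^+ j != 0))) => [j|hx].
  by case/andP; exists j.
have q0 : \sum_i q.[x i] = 0.
  under eq_bigr => i _ do rewrite horner_coef.
  rewrite exchange_big /= big1 // => j _; rewrite -mulr_sumr.
  case: (posnP j) => [->|j0]; first by rewrite coefXM eqxx mul0r.
  by have := hx j; rewrite j0 /= => /negbFE/eqP->; rewrite mulr0.
have qN i : x i != x i0 -> q.[x i] = 0.
  by move=> ne; rewrite hornerM (bigD1 i) //= hornerM hornerXsubC subrr mul0r mulr0.
have qE i : x i = x i0 -> q.[x i] = q.[x i0] by move->.
have : \sum_i q.[x i] = q.[x i0] *+ #|[pred i | x i == x i0]|.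
  rewrite (bigID (fun i => x i == x i0)) /= [X in _ + X]big1 // addr0.
  by rewrite -sumr_const; apply: eq_bigr => i /eqP/qE.
move/esym/eqP; rewrite q0 -mulr_natr mulf_eq0 char0_natr_eq0 // => /orP[|].
  rewrite hornerM hornerX mulf_eq0 (negPf x0) horner_prod => /prodf_eq0[i ne].
  by rewrite hornerXsubC subr_eq0 eq_sym (negPf ne).
by move=> /eqP/card0_eq/(_ i0); rewrite inE eqxx.
Qed.

(** * Pairing distinct roots *)

Definition half_index e (t : 'I_e * bool) : nat := if t.2 then t.1 : nat else (e + t.1)%N.

Lemma big_half_index (R : comNzRingType) (A : Type) (x0 : A) e (s : seq A) (F : A -> R) :
  size s = (e * 2)%N ->
  \prod_(u <- s) F u = \prod_(t : 'I_e * bool) F (nth x0 s (half_index t)).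
Proof.
move=> ss; rewrite (big_nth x0) ss big_mkord muln2 -addnn big_split_ord /=.
rewrite -(pair_bigA _ (fun i b => F (nth x0 s (half_index (i, b))))) /=.
rewrite -big_split /=; apply: eq_bigr => i _.
by rewrite big_bool.
Qed.

(* If the most frequent letter occurs at most e times, sorting puts equal
   letters at distance less than e. *)
Lemma perm_matching (A : eqType) (x0 : A) e (s : seq A) :
  size s = (e * 2)%N -> (forall x, (count_mem x s <= e)%N) ->
  exists2 s', perm_eq s s' &
    forall i : 'I_e, nth x0 s' (half_index (i, true)) != nth x0 s' (half_index (i, false)).
Proof.
(* An [eqType] carries no order, so letters are compared by their first occurrence in [s]; letters
   of [s] that tie are equal. *)
move=> ss cs; pose r a b := (index a s <= index b s)%N.
have r_total : total r by move=> a b; apply: leq_total.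
have r_trans : transitive r by move=> b a c; apply: leq_trans.
pose s' := sort r s; have ps : perm_eq s s' by rewrite perm_sym perm_sort.
exists s' => // i; apply/negP => /eqP; rewrite /half_index /=.
set x := nth x0 s' i => Dx.
have ss' : size s' = (e * 2)%N by rewrite size_sort.
have lti := ltn_ord i.
have nth_r a b : (a <= b < e * 2)%N -> (index (nth x0 s' a) s <= index (nth x0 s' b) s)%N.
  move=> /andP[ab b2]; apply: (sorted_leq_nth r_trans _ x0 (sort_sorted r_total s)) => //.
  - by move=> y; apply: leqnn.
  - by rewrite inE ss'; lia.
  - by rewrite inE ss'.
(* Equal letters at positions [i] and [e + i] of a sorted list force [e + 1] consecutive copies of
   [x], against the bound on its count. *)
have nthx j : (i <= j <= e + i)%N -> nth x0 s' j = x.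
  move=> /andP[ij je].
  have lj : (j < e * 2)%N by lia.
  have ins b : (b < e * 2)%N -> nth x0 s' b \in s.
    by move=> b2; rewrite (perm_mem ps) mem_nth ?ss'.
  have Ij : index (nth x0 s' j) s = index x s.
    apply/eqP; rewrite eqn_leq andbC nth_r; last by rewrite ij.
    by rewrite Dx nth_r // je; lia.
  have xs : x \in s by apply: ins; lia.
  by rewrite -(nth_index x0 xs) -Ij nth_index // ins.
have := cs x; rewrite leqNgt => /negP; apply.
rewrite (seq.permP ps) -(cat_take_drop i s') count_cat.
apply: leq_trans (leq_addl _ _).
rewrite -(cat_take_drop e.+1 (drop i s')) count_cat.
apply: leq_trans (leq_addr _ _).
have sz : size (take e.+1 (drop i s')) = e.+1.
  by rewrite size_take size_drop ss'; case: ifP => //; lia.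
rewrite -[X in (X <= _)%N]sz; apply: eq_leq; apply/esym/eqP; rewrite -all_count.
apply/(all_nthP x0) => j; rewrite sz => lj.
by rewrite nth_take // nth_drop /= nthx //; lia.
Qed.

(** * Invariants of semistable forms *)

Section SemistableForms.
Variable k : closedFieldType.
Hypothesis hk : [pchar k] =i pred0.

Lemma matching_sum_lact e N (g : 'M[k]_2) l : SL2 g ->
  @matching_sum k e N (fun t => lact g (l t)) = @matching_sum k e N l.
Proof.
move=> g1; apply: eq_bigr => s _; congr (_ ^+ _); apply: eq_bigr => i _.
by rewrite br_lact g1 mul1r.
Qed.

(** In the order given by [perm_matching] the identity permutation contributes a nonzero product of
    brackets; [power_sum_neq0] then finds an [N] for which the matching sum is nonzero at [p]. *)
Lemma semistable_invariant e (p : {poly k}) c (s : seq (option k)) :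
  (0 < e)%N -> c != 0 -> size s = (e * 2)%N -> (forall q, (count_mem q s <= e)%N) ->
  p = c *: \prod_(q <- s) lform (point q) ->
  exists L : seq (k * seq (k * k)),
    [/\ forall g (p' : {poly k}), SL2 g -> (size p' <= (e * 2).+1)%N ->
          evpoly (e * 2) L (actf (e * 2) g p') = evpoly (e * 2) L p',
        evpoly (e * 2) L 0 = 0 & evpoly (e * 2) L p != 0].
Proof.
move=> e0 c0 ss cs Dp; have e20 : (0 < e * 2)%N by lia.
have cardT : #|{: 'I_e * bool}| = (e * 2)%N by rewrite card_prod card_ord card_bool.
have [s' ps s'P] := perm_matching None ss cs.
have ss' : size s' = (e * 2)%N by rewrite -(perm_size ps).
have [x Dx] := exists_root c e20.
have x0 : x != 0 by apply: contra_neq c0 => x0; rewrite -Dx x0 expr0n eqn0Ngt e20.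
pose l t := scalep x (point (nth None s' (half_index (e := e) t))).
have {}Dp : p = \prod_t lform (l t).
  rewrite Dp (perm_big _ ps) /=.
  rewrite -(big_half_index None (fun q => lform (scalep x (point q))) ss').
  by rewrite prod_lform_scalep ss' Dx.
pose X (s : {perm 'I_e * bool}) := \prod_(i < e) br (l (s (i, true))) (l (s (i, false))).
have X1 : X 1%g != 0.
  apply/prodf_neq0 => i _; rewrite !perm1 /br /l /scalep /=.
  rewrite (_ : _ - _ = x ^+ 2 * br (point (nth None s' (half_index (i, true))))
                 (point (nth None s' (half_index (i, false))))); last first.
    by rewrite /br; ring.
  by rewrite mulf_neq0 ?expf_neq0 ?br_point_neq0 ?s'P.
have [N N0 XN] := power_sum_neq0 hk X1.
have [L HL] := @symfun_matching_sum k e N N0; rewrite cardT in HL.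
exists L; split; last by rewrite Dp HL.
  move=> g p' g1 sp'; have [r sr ->] := form_split e20 sp'.
  have -> : actf (e * 2) g (\prod_(u <- r) lform u) = \prod_(u <- r) lform (lact g u).
    by rewrite -sr actf_prod_lform.
  rewrite (big_half_index (0, 0) (fun u => lform u) sr).
  by rewrite (big_half_index (0, 0) (fun u => lform (lact g u)) sr) !HL matching_sum_lact.
rewrite (_ : 0 = \prod_(t : 'I_e * bool) lform (0, 0) :> {poly k}); last first.
  by rewrite prodr_const cardT /lform /= scale0r addr0 expr0n; case: (e) e0.
rewrite (HL (fun=> (0, 0))) /matching_sum big1 // => s0 _.
by case: (e) e0 s0 => // n _ s0; rewrite big_ord_recl /br /= mul0r subrr mul0r expr0n; case: (N) N0.
Qed.

End SemistableForms.

(* [nilat d q p]: q is a root of multiplicity greater than d/2 of the form p of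
   degree d; the point q = None is the one at infinity. *)
Definition nilat (k : fieldType) (d : nat) (q : option k) (p : {poly k}) : bool :=
  if q is Some r then ('X - r%:P) ^+ (d./2.+1) %| p else (size p <= uphalf d)%N.

(** * Roots of multiplicity above half the degree *)

Section RootMultiplicity.
Variable k : closedFieldType.
Implicit Types (p : {poly k}) (q : option k).

Lemma nilat0 d q : nilat d q (0 : {poly k}).
Proof. by case: q => [r|] /=; rewrite ?dvdp0 // size_poly0. Qed.

Lemma nilatD d q p p' : nilat d q p -> nilat d q p' -> nilat d q (p + p').
Proof.
case: q => [r|] /=; first exact: dvdp_add.
by move=> sp sp'; rewrite (leq_trans (size_polyD _ _)) // geq_max sp.
Qed.

Lemma nilatZ d q c p : nilat d q p -> nilat d q (c *: p).
Proof.
case: q => [r|] /=; last by apply: leq_trans; apply: size_scale_leq.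
by move=> hp; rewrite -mul_polyC dvdp_mull.
Qed.

Lemma dvdp_count r (s : seq (option k)) :
  ('X - r%:P) ^+ count_mem (Some r) s %| \prod_(q <- s) lform (point q).
Proof.
elim: s => [|q s IHs]; first by rewrite big_nil dvd1p.
rewrite big_cons /=; have [->|_] := eqVneq q (Some r).
  by rewrite exprS dvdp_mul // lform_Some.
by rewrite add0n dvdp_mull.
Qed.

Lemma size_prod_point (s : seq (option k)) :
  (size (\prod_(q <- s) lform (point q))%R + count_mem None s <= (size s).+1)%N.
Proof.
elim: s => [|q s IHs]; first by rewrite big_nil size_poly1.
rewrite big_cons /=; case: q => [r|]; last by rewrite lform_None mul1r addnCA /= ltnS.
rewrite lform_Some; have le_M := size_polyMleq ('X - r%:P) (\prod_(q <- s) lform (point q)).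
rewrite size_XsubC add2n /= in le_M.
by apply: leq_trans (leq_add le_M (leqnn _)) _; rewrite addSn ltnS.
Qed.

Lemma nilat_count d q c (s : seq (option k)) : size s = d -> (d < 2 * count_mem q s)%N ->
  nilat d q (c *: \prod_(q <- s) lform (point q)).
Proof.
move=> ss lt_d; apply: nilatZ; case: q lt_d => [r|] lt_d /=.
  apply: dvdp_trans (dvdp_count r s); apply: dvdp_exp2l; move: lt_d.
  by set b := count _ _; lia.
have := size_prod_point s; rewrite ss; move: lt_d.
by set a := size (polyseq _); set b := count _ _; lia.
Qed.

(** Each such point takes up at least [d./2.+1] roots of a nonzero form of degree [d], so two do not
    fit. At infinity, size at most [uphalf d] means just this multiplicity. *)
Lemma nilat_uniq d q q' p : (size p <= d.+1)%N -> p != 0 ->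
  nilat d q p -> nilat d q' p -> q = q'.
Proof.
have inf_fin r : (size p <= uphalf d)%N -> p != 0 -> ~ ('X - r%:P) ^+ (d./2.+1) %| p.
  move=> s1 p0 /(dvdp_leq p0); rewrite size_exp_XsubC.
  by have := uphalf_half d; move: s1; set a := size (polyseq _); lia.
move=> sp p0; case: q q' => [r|] [r'|] //= h h'; last 2 first.
- by case: (inf_fin r h' p0).
- by case: (inf_fin r' h p0).
have [->//|ne] := eqVneq r r'.
have cop : coprimep (('X - r%:P) ^+ (d./2.+1)) (('X - r'%:P) ^+ (d./2.+1)).
  by rewrite coprimep_expl // coprimep_expr // coprimep_XsubC root_XsubC eq_sym.
have : ('X - r%:P) ^+ (d./2.+1) * ('X - r'%:P) ^+ (d./2.+1) %| p by rewrite Gauss_dvdp // h.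
move/(dvdp_leq p0); rewrite size_Mmonic ?monic_exp ?monicXsubC ?expf_neq0 ?polyXsubC_eq0 //.
by rewrite !size_exp_XsubC; move: sp; set a := size (polyseq _); lia.
Qed.

End RootMultiplicity.

(** * The component forms of a vector *)

Section Components.
Variables (k : fieldType) (m : nat) (d : 'I_m -> nat).
Implicit Types (v : 'rV[k]_(dimV d)) (i : 'I_m).

Definition form v i : {poly k} := rVpoly (@submxrow k m (fun i => (d i).+1) 1 v i).

Lemma size_form v i : (size (form v i) <= (d i).+1)%N.
Proof. exact: size_poly. Qed.

Definition coord i (j : 'I_(d i).+1) : 'I_(dimV d) :=
  @tagnat.Rank m (fun i => (d i).+1) i j.

Lemma coef_form v i (j : 'I_(d i).+1) : (form v i)`_j = v 0 (coord j).
Proof. by rewrite coef_rVpoly_ord mxE. Qed.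

Lemma formD v v' i : form (v + v') i = form v i + form v' i.
Proof. by rewrite /form submxrowD linearD. Qed.

Lemma formZ c v i : form (c *: v) i = c *: form v i.
Proof.
apply/polyP => j; rewrite coefZ !coef_rVpoly.
by case: insub => [u|]; rewrite ?mulr0 ?mxE.
Qed.

Lemma form_act g v i : form (v *m rhoV d g) i = actf (d i) g (form v i).
Proof.
have -> : v *m rhoV d g = \mxrow_i (@submxrow k m (fun i => (d i).+1) 1 v i *m rho (d i) g).
  by rewrite -mul_mxrow_mxdiag submxrowK.
rewrite /form mxrowK; apply/polyP => l; have := size_actf (d i) g (form v i).
case: (ltnP l (d i).+1) => ltl sz; last first.
  by rewrite !nth_default ?(leq_trans _ ltl) // size_poly.
rewrite (coef_rVpoly_ord _ (Ordinal ltl)) mxE actfE coef_sum; apply: eq_bigr => j _.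
by rewrite coef_form !mxE coefZ /lform.
Qed.

End Components.

(** * Polynomial functions on [V] and its null cone *)

Section PolynomialFunctions.
Variables (k : fieldType) (m : nat) (d : 'I_m -> nat).
Implicit Types (F : 'rV[k]_(dimV d) -> k) (v : 'rV[k]_(dimV d)).

Definition polyfun F : Prop :=
  exists f : {mpoly k[dimV d]}, forall v, f.@[fun j => v 0 j] = F v.

Lemma eq_polyfun F F' : F =1 F' -> polyfun F -> polyfun F'.
Proof. by move=> eqF [f Hf]; exists f => v; rewrite Hf. Qed.

Lemma polyfun_cst c : polyfun (fun=> c).
Proof. by exists c%:MP => v; rewrite mevalC. Qed.

Lemma polyfunD F F' : polyfun F -> polyfun F' -> polyfun (fun v => F v + F' v).
Proof. by move=> [f Hf] [f' Hf']; exists (f + f') => v; rewrite mevalD Hf Hf'. Qed.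

Lemma polyfunM F F' : polyfun F -> polyfun F' -> polyfun (fun v => F v * F' v).
Proof. by move=> [f Hf] [f' Hf']; exists (f * f') => v; rewrite mevalM Hf Hf'. Qed.

Lemma polyfunX F n : polyfun F -> polyfun (fun v => F v ^+ n).
Proof. by move=> [f Hf]; exists (f ^+ n) => v; rewrite rmorphXn /= Hf. Qed.

Lemma polyfun_sum (I : Type) (r : seq I) (F : I -> 'rV[k]_(dimV d) -> k) :
  (forall i, polyfun (F i)) -> polyfun (fun v => \sum_(i <- r) F i v).
Proof.
move=> HF; elim: r => [|i r IHr].
  by apply: (eq_polyfun _ (polyfun_cst 0)) => v; rewrite big_nil.
by apply: (eq_polyfun _ (polyfunD (HF i) IHr)) => v; rewrite big_cons.
Qed.

Lemma polyfun_prod (I : Type) (r : seq I) (F : I -> 'rV[k]_(dimV d) -> k) :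
  (forall i, polyfun (F i)) -> polyfun (fun v => \prod_(i <- r) F i v).
Proof.
move=> HF; elim: r => [|i r IHr].
  by apply: (eq_polyfun _ (polyfun_cst 1)) => v; rewrite big_nil.
by apply: (eq_polyfun _ (polyfunM (HF i) IHr)) => v; rewrite big_cons.
Qed.

Lemma polyfun_coord t : polyfun (fun v => v 0 t).
Proof. by exists 'X_t => v; rewrite mevalXU. Qed.

Lemma polyfun_hev i x y : polyfun (fun v => hev (d i) (form v i) x y).
Proof.
apply: polyfun_sum => j; apply: polyfunM; last exact: polyfun_cst.
by apply: (eq_polyfun _ (polyfun_coord (coord j))) => v; rewrite coef_form.
Qed.

(** The value of a product of forms is the product of their values, each linear in the
    coordinates. *)
Lemma polyfun_evpoly (i j : 'I_m) a b L :
  polyfun (fun v => evpoly (a * d i + b * d j) L (form v i ^+ a * form v j ^+ b)).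
Proof.
apply: polyfun_sum => c; apply: polyfunM; first exact: polyfun_cst.
apply: polyfun_prod => u.
apply: (eq_polyfun _ (polyfunM (polyfunX a (polyfun_hev i u.1 u.2))
                               (polyfunX b (polyfun_hev j u.1 u.2)))) => v.
by rewrite hevM ?size_hexp ?size_form // !hevX ?size_form.
Qed.

Definition unstable (v : 'rV[k]_(dimV d)) : Prop :=
  forall f : {mpoly k[dimV d]}, Defs.invariant f ->
    f.@[fun j => v 0 j] = f.@[fun j => (0 : 'rV[k]_(dimV d)) 0 j].

Lemma unstable_polyfun v F : unstable v -> polyfun F ->
  (forall g v, SL2 g -> F (v *m rhoV d g) = F v) -> F v = F 0.
Proof.
by move=> uv [f Hf] Finv; rewrite -!Hf; apply: uv => g v' g1; rewrite !Hf Finv.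
Qed.

End PolynomialFunctions.

(** * The Hilbert-Mumford criterion *)

Definition mult (k : closedFieldType) (q : option k) (s : seq (option k)) : nat :=
  count_mem q s.

Section HilbertMumford.
Variables (k : closedFieldType) (m : nat) (d : 'I_m -> nat).
Hypothesis hk : [pchar k] =i pred0.
Implicit Types (v : 'rV[k]_(dimV d)).

Lemma form0 i : form (0 : 'rV[k]_(dimV d)) i = 0.
Proof. by rewrite -(scale0r 0) formZ scale0r. Qed.

(** A form of degree 0 is fixed by the action, so its coefficient is an invariant. *)
Lemma unstable_degree0 v i : unstable v -> d i = 0%N -> form v i = 0.
Proof.
move=> uv di; have sf := size_form v i; rewrite di in sf.
rewrite (size1_polyC sf) (coef_form v (ord0 : 'I_(d i).+1)).
rewrite (unstable_polyfun uv (polyfun_coord k (coord (ord0 : 'I_(d i).+1)))) ?mxE // => g v' _.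
have E0 (w : 'rV[k]_(dimV d)) : w 0 (coord (ord0 : 'I_(d i).+1)) = (form w i)`_0.
  by rewrite -(coef_form w (ord0 : 'I_(d i).+1)).
rewrite !E0 form_act actfE di big_ord1.
by rewrite subn0 !expr0 coefZ mul1r coef1 mulr1.
Qed.

Lemma prod_form_factor (a b : nat) ci cj (si sj : seq (option k)) :
  (ci *: \prod_(q <- si) lform (point q)) ^+ a * (cj *: \prod_(q <- sj) lform (point q)) ^+ b
  = (ci ^+ a * cj ^+ b) *:
      \prod_(q <- flatten (nseq a si ++ nseq b sj)) lform (point q).
Proof.
rewrite flatten_cat big_cat !exprZn /= -scalerAl -scalerAr scalerA; congr (_ *: (_ * _)).
  by elim: a => [|a IHa]; rewrite ?big_nil // exprS IHa /= big_cat.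
by elim: b => [|b IHb]; rewrite ?big_nil // exprS IHb /= big_cat.
Qed.

Lemma count_flatten_nseq (A : Type) (P : pred A) a b (si sj : seq A) :
  count P (flatten (nseq a si ++ nseq b sj)) = (a * count P si + b * count P sj)%N.
Proof.
by rewrite count_flatten map_cat sumn_cat !map_nseq !sumn_nseq ![(_ * count P _)%N]mulnC.
Qed.

Lemma unstable_pair v i j a b ci cj (si sj : seq (option k)) :
  unstable v -> ci != 0 -> cj != 0 -> size si = d i -> size sj = d j ->
  form v i = ci *: \prod_(q <- si) lform (point q) ->
  form v j = cj *: \prod_(q <- sj) lform (point q) ->
  (0 < a * d i + b * d j)%N ->
  ~ forall q, (2 * (a * mult q si + b * mult q sj) <= a * d i + b * d j)%N.
Proof.
move=> uv ci0 cj0 ssi ssj Di Dj e0 cq; set e := (_ + _)%N in e0 cq.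
have eD : (e * 2 = a * 2 * d i + b * 2 * d j)%N by rewrite /e; lia.
have [| |q| |L [Linv L0]] := @semistable_invariant k hk e (form v i ^+ (a * 2) * form v j ^+ (b * 2))
  (ci ^+ (a * 2) * cj ^+ (b * 2)) (flatten (nseq (a * 2) si ++ nseq (b * 2) sj)) e0.
- by rewrite mulf_neq0 ?expf_neq0.
- by rewrite -!count_predT count_flatten_nseq !count_predT ssi ssj.
- by rewrite count_flatten_nseq (leq_trans _ (cq q)) // /mult; lia.
- by rewrite Di Dj prod_form_factor.
have szp (w : 'rV[k]_(dimV d)) : (size (form w i ^+ (a * 2) * form w j ^+ (b * 2))%R <= (e * 2).+1)%N.
  have hi := size_hexp (a * 2) (size_form w i); have hj := size_hexp (b * 2) (size_form w j).
  apply: leq_trans (size_polyMleq _ _) _; rewrite eD -subn1 leq_subLR.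
  apply: leq_trans (leq_add hi hj) _; lia.
rewrite eD => /negP; apply; apply/eqP.
rewrite (unstable_polyfun uv (@polyfun_evpoly k m d i j (a * 2) (b * 2) L)).
  rewrite !form0 -{}L0 eD; congr (evpoly _ _ _).
  have [a0|a0] := posnP a; last by rewrite expr0n; case: (a) a0 => // n _; rewrite mul0r.
  have [b0|b0] := posnP b; last by rewrite mulrC expr0n; case: (b) b0 => // n _; rewrite mul0r.
  by rewrite /e a0 b0 in e0.
move=> g w g1; rewrite -[in RHS]eD -[RHS](Linv g) // eD !form_act; congr (evpoly _ _ _).
by rewrite actfM ?size_hexp ?size_form // !actfX ?size_form.
Qed.

(** Add [B] times the first bound to [A] times the second: the terms in [A * B] cancel. *)
Lemma weighted_leq A B x y p n :
  (2 * x <= p + A)%N -> (2 * y + B <= n)%N -> (2 * (B * x + A * y) <= B * p + A * n)%N.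
Proof.
by move=> hx hy; have := leq_mul (leqnn B) hx; have := leq_mul (leqnn A) hy; nia.
Qed.

Lemma unstable_nilat v : unstable v -> exists q, forall i, nilat (d i) q (form v i).
Proof.
move=> uv; case: (pickP (fun i => form v i != 0)) => [i0 f0|f0]; last first.
  by exists None => i; rewrite (eqP (negbFE (f0 i))) nilat0.
have dpos i : form v i != 0 -> (0 < d i)%N.
  by move=> fi; rewrite lt0n; apply: contra_neq fi; apply: unstable_degree0.
have major i c s : c != 0 -> size s = d i -> form v i != 0 ->
    form v i = c *: \prod_(q <- s) lform (point q) ->
    exists q, (d i < 2 * mult q s)%N.
  move=> c0 ss fi Di; case: (boolP (has (fun q => d i < 2 * mult q s)%N s)).
    by case/hasP => q _ hq; exists q.
  move=> /hasPn hs; case: (@unstable_pair v i i 1 0 c c s s) => //.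
    by rewrite mul0n addn0 mul1n dpos.
  move=> q; rewrite !mul0n !addn0 !mul1n; case: (boolP (q \in s)) => [/hs|/count_memPn].
    by rewrite -leqNgt.
  by rewrite /mult => ->; rewrite muln0.
have [c0 c00 [s0 ss0 D0]] := form_factor (size_form v i0) f0.
have [q0 hq0] := major _ _ _ c00 ss0 f0 D0.
exists q0 => j; have [->|fj] := eqVneq (form v j) 0; first exact: nilat0.
have [cj cj0 [sj ssj Dj]] := form_factor (size_form v j) fj.
have [hj|hj] := ltnP (d j) (2 * mult q0 sj); first by rewrite Dj; apply: nilat_count.
have [q1 hq1] := major _ _ _ cj0 ssj fj Dj.
have q01 : q0 != q1 by apply: contraTneq hq1 => <-; rewrite -leqNgt.
have count2 (s : seq (option k)) q q' :
    q != q' -> (mult q s + mult q' s <= size s)%N.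
  move=> ne; rewrite /mult -count_predUI [X in (_ + X)%N](eq_count (a2 := pred0)) ?count_pred0 ?addn0 ?count_size //.
  move=> x; change ((x == q) && (x == q') = false).
  by case: eqP => // ->; apply/negbTE.
(* Each component is raised to the excess of the other, twice its top multiplicity minus its degree.
   The surplus of one factor at [q0] or [q1] is then offset by the deficit of the other. *)
case: (@unstable_pair v i0 j (2 * mult q1 sj - d j) (2 * mult q0 s0 - d i0)
         c0 cj s0 sj) => //.
  by have := dpos _ f0; nia.
have c01 := count2 s0 q0 q1 q01; have cj01 := count2 sj q0 q1 q01.
move=> q; have cq0 := count2 s0 q q0; have cq1 := count2 sj q q1.
rewrite ss0 in c01 cq0; rewrite ssj in cj01 cq1.
have [Dq|nq1] := eqVneq q q1.
  have /cq0 {}cq0 : q != q0 by rewrite Dq eq_sym.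
  rewrite addnC [leqRHS]addnC; apply: weighted_leq; last by lia.
  by rewrite Dq; lia.
have {}cq1 := cq1 nq1; apply: weighted_leq; last by lia.
by have [->|/cq0] := eqVneq q q0; lia.
Qed.

End HilbertMumford.

(** * Polynomial identities in characteristic 0 *)

Section InfiniteField.
Variable k : fieldType.
Hypothesis hk : [pchar k] =i pred0.

(** The sample points start at 1 so that they can serve as torus parameters. *)
Lemma poly_eq0_nat (p : {poly k}) : (forall n : nat, p.[n.+1%:R] = 0) -> p = 0.
Proof.
move=> hp; apply: (@roots_geq_poly_eq0 _ p [seq n.+1%:R | n <- iota 0 (size p)]).
- by apply/allP => _ /mapP[n _ ->]; apply/rootP.
- rewrite map_inj_uniq ?iota_uniq // => a b.
  wlog ab : a b / (a <= b)%N => [H eq_ab|].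
    by case: (leqP a b) => [ab|/ltnW ab]; [|apply/esym]; apply: H.
  move/eqP; rewrite eq_sym -subr_eq0 -natrB ?ltnS // subSS char0_natr_eq0 // subn_eq0 => ba.
  by apply/eqP; rewrite eqn_leq ab.
- by rewrite size_map size_iota.
Qed.

Lemma horner_mmap n (h : 'I_n -> {poly k}) (f : {mpoly k[n]}) s :
  (mmap polyC h f).[s] = f.@[fun i => (h i).[s]].
Proof.
rewrite /mmap mevalE horner_sum; apply: eq_bigr => m _.
rewrite hornerM hornerC /mmap1 horner_prod; congr (_ * _).
by apply: eq_bigr => i _; rewrite horner_exp.
Qed.

Lemma digits_inj n B (a b : 'I_n -> nat) :
  (forall i, a i < B)%N -> (forall i, b i < B)%N ->
  (\sum_i a i * B ^ i = \sum_i b i * B ^ i)%N -> a =1 b.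
Proof.
elim: n a b => [|n IHn] a b ha hb; first by move=> _ [].
have E (c : 'I_n.+1 -> nat) :
    (\sum_i c i * B ^ i = c ord0 + B * \sum_(i < n) c (lift ord0 i) * B ^ i)%N.
  rewrite big_ord_recl muln1 big_distrr; congr addn.
  by apply: eq_bigr => i _; rewrite /= expnS mulnCA.
rewrite !E => eq_ab; have B0 : (0 < B)%N by apply: leq_ltn_trans (ha ord0).
have eq0 : a ord0 = b ord0.
  move/(congr1 (modn^~ B)): eq_ab.
  by rewrite /= addnC mulnC modnMDl [in RHS]addnC [in RHS]mulnC modnMDl !modn_small.
move: eq_ab; rewrite eq0 => /eqP; rewrite eqn_add2l eqn_pmul2l // => /eqP/IHn eqS i.
by case: (unliftP ord0 i) => [j ->|-> //]; apply: eqS.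
Qed.

(* Kronecker substitution reduces to one variable. *)
Lemma mpoly_eq0 n (f : {mpoly k[n]}) : (forall x, f.@[x] = 0) -> f = 0.
Proof.
(* [msize f] exceeds all exponents in [f], which are thus digits in base [B]: distinct monomials get
   distinct powers. *)
move=> hf; pose B := msize f.
pose K (m : 'X_{1..n}) := (\sum_i m i * B ^ i)%N.
have K0 : mmap polyC (fun i => 'X^(B ^ i)%N) f = 0.
  by apply: poly_eq0_nat => a; rewrite horner_mmap hf.
have ltB (m : 'X_{1..n}) i : m \in msupp f -> (m i < B)%N.
  move=> mf; apply: leq_ltn_trans (msize_mdeg_lt mf).
  by rewrite mdegE (bigD1 i) //= leq_addr.
apply/mpolyP => m; rewrite mcoeff0; apply/eqP; rewrite mcoeff_eq0; apply/negP => mf.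
have := congr1 (fun p : {poly k} => p`_(K m)) K0; rewrite /mmap coef_sum coef0.
have termE (m' : 'X_{1..n}) : mmap1 (fun i => 'X^(B ^ i)%N) m' = 'X^(K m') :> {poly k}.
  rewrite /mmap1 expr_sum; apply: eq_bigr => i _.
  by rewrite -exprM mulnC.
rewrite (bigD1_seq m) ?msupp_uniq //= termE coefCM coefXn eqxx mulr1 big1_seq.
  by rewrite addr0 => /eqP; rewrite mcoeff_eq0 mf.
move=> m' /andP[ne mf']; rewrite termE coefCM coefXn; case: eqP => [eqK|]; last by rewrite mulr0.
case/eqP: ne; apply/mnmP => i; apply/esym; move: i.
by apply: (@digits_inj _ B) => // i; apply: ltB.
Qed.

Lemma mpoly_ext n (f g : {mpoly k[n]}) : (forall x, f.@[x] = g.@[x]) -> f = g.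
Proof.
move=> fg; apply/eqP; rewrite -subr_eq0; apply/eqP/mpoly_eq0 => x.
by rewrite mevalB fg subrr.
Qed.

Lemma deriv_eq0 (p : {poly k}) : p^`() = 0 -> (size p <= 1)%N.
Proof.
move=> p0; apply/leq_sizeP => -[//|j] _; apply/eqP.
have := coef_deriv p j; rewrite p0 coef0 -mulr_natr => /esym/eqP.
by rewrite mulf_eq0 char0_natr_eq0 // orbF.
Qed.

(** The relation passes to the coprime quotients by the gcd. There [p1] divides its own derivative,
    which must vanish, and both quotients are constant. *)
Lemma wronskian_eq0 (p r : {poly k}) : p != 0 -> p * r^`() = p^`() * r ->
  exists c, r = c *: p.
Proof.
move=> p0 W; set g := gcdp p r.
have g0 : g != 0 by rewrite gcdp_eq0 negb_and p0.
have Dp : p = (p %/ g) * g by rewrite divpK ?dvdp_gcdl.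
have Dr : r = (r %/ g) * g by rewrite divpK ?dvdp_gcdr.
have cop : coprimep (p %/ g) (r %/ g) by rewrite coprimep_div_gcd // p0.
move: Dp Dr cop; set p1 := p %/ g; set r1 := r %/ g => Dp Dr cop.
have p10 : p1 != 0 by apply: contra_neq p0 => p10; rewrite Dp p10 mul0r.
have W1 : p1 * r1^`() = p1^`() * r1.
  apply: (mulIf g0); apply: (mulIf g0); move: W; rewrite Dp Dr !derivM => W.
  apply/eqP; rewrite -subr_eq0; apply/eqP; move/eqP: W; rewrite -subr_eq0 => /eqP <-; ring.
have dp1 : p1^`() = 0.
  apply/eqP/negPn/negP => dp0.
  have : p1 %| p1^`() by rewrite -(Gauss_dvdpl _ cop) -W1 dvdp_mulr.
  by move/(dvdp_leq dp0); rewrite leqNgt lt_size_deriv.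
move/eqP: W1; rewrite dp1 mul0r mulf_eq0 (negPf p10) /= => /eqP dr1.
have := size1_polyC (deriv_eq0 dp1); have := size1_polyC (deriv_eq0 dr1).
move: (r1`_0) (p1`_0) => c1 c0 Er Ep.
have c00 : c0 != 0 by apply: contra_neq p10 => c00; rewrite Ep c00.
by exists (c1 / c0); rewrite Dr Dp Er Ep !mul_polyC scalerA divfK.
Qed.

End InfiniteField.

(** * Contraction to 0 by a one-parameter subgroup *)

Definition mx2 (k : nzRingType) (a b c e : k) : 'M[k]_2 :=
  \matrix_(i, j) if i == 0 then if j == 0 then a else b else if j == 0 then c else e.

Section DestabilizingTorus.
Variables (k : fieldType) (m : nat) (d : 'I_m -> nat).
Hypothesis hk : [pchar k] =i pred0.

Lemma SL2_mx2 (a b c e : k) : a * e - b * c = 1 -> SL2 (mx2 a b c e).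
Proof. by move=> D; rewrite /SL2 det_mx22 !mxE. Qed.

(** [g] depends on [q] alone and moves this point to 0, so a form of degree [d] nilpotent at [q]
    becomes divisible by ['X^(d./2.+1)]. *)
Lemma nilat_actf (q : option k) : exists2 g, SL2 g &
  forall d (p : {poly k}) j, (size p <= d.+1)%N -> nilat d q p ->
    (2 * j <= d)%N -> (actf d g p)`_j = 0.
Proof.
pose g := if q is Some r then mx2 1 0 r 1 else mx2 0 1 (-1) 0.
have g1 : SL2 g by rewrite /g; case: (q) => [r|]; apply: SL2_mx2; ring.
have gX : actf 1 g (lform (point q)) = 'X.
  rewrite actf_lform /lform /lact /g; case: (q) => [r|] /=; rewrite !mxE /=.
    by rewrite !(mulr1, mul1r, mulr0, addNr, add0r) scale1r.
  by rewrite !(mulr1, mul1r, mulr0, mul0r, addr0, add0r) scale1r.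
exists g => // e p j sp np je.
have [->|p0] := eqVneq p 0; first by rewrite /actf map_poly0 hev0 coef0.
have [u su Dp] : exists2 u : {poly k}, (size u <= (e - e./2.+1).+1)%N &
    p = lform (point q) ^+ (e./2.+1) * u.
  case: (q) np => [r|] /= np; last first.
    exists p; last by rewrite /lform /= scale0r addr0 expr1n mul1r.
    have := uphalf_half e; have : (0 < size p)%N by rewrite size_poly_gt0.
    by move: np; set a := size (polyseq _); lia.
  have -> : lform (- r, 1) = 'X - r%:P by rewrite /lform /= scale1r polyCN addrC.
  case/dvdpP: np => u Du; exists u; last by rewrite Du mulrC.
  have u0 : u != 0 by apply: contra_neq p0 => u0; rewrite Du u0 mul0r.
  move: sp; rewrite Du size_Mmonic ?monic_exp ?monicXsubC // size_exp_XsubC.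
  by set a := size (polyseq _); lia.
have led : (e./2.+1 <= e)%N.
  rewrite ltnNge; apply/negP => dd.
  have e0 : e = 0%N by lia.
  move: np sp; rewrite e0; case: (q) => [r|] /=.
    by move=> /(dvdp_leq p0); rewrite size_exp_XsubC => /leq_trans h /h.
  by rewrite leqn0 size_poly_eq0 (negPf p0).
have De : e = (e./2.+1 * 1 + (e - e./2.+1))%N by rewrite muln1 subnKC.
rewrite Dp {1}De actfM ?size_hexp ?size_lform // actfX ?size_lform // gX coefXnM.
by have -> : (j < e./2.+1)%N by lia.
Qed.

Lemma coef_actf_torus e (p : {poly k}) (s : k) j : (j <= e)%N ->
  (actf e (mx2 s^-1 0 0 s) p)`_j = p`_j * (s^-1 ^+ (e - j) * s ^+ j).
Proof.
move=> je; have lje : (j < e.+1)%N by [].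
have lf0 : lform (s^-1, 0) = (s^-1)%:P by rewrite /lform /= scale0r addr0.
have lf1 : lform (0, s) = s *: 'X by rewrite /lform /= add0r.
have E i : (lform (mx2 s^-1 0 0 s 0 0, mx2 s^-1 0 0 s 0 1) ^+ (e - i) *
            lform (mx2 s^-1 0 0 s 1 0, mx2 s^-1 0 0 s 1 1) ^+ i)`_j
           = (s^-1 ^+ (e - i) * s ^+ i) * (j == i)%:R.
  by rewrite !mxE /= lf0 lf1 -rmorphXn exprZn /= mul_polyC scalerA coefZ coefXn.
rewrite actfE coef_sum (bigD1 (Ordinal lje)) //= coefZ E eqxx mulr1 big1 ?addr0 // => i.
by rewrite -val_eqE /= => ne; rewrite coefZ E eq_sym (negPf ne) !mulr0.
Qed.

Lemma torus_weight (s : k) e j : s != 0 -> (j <= e)%N -> (e <= 2 * j)%N ->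
  s^-1 ^+ (e - j) * s ^+ j = s ^+ (2 * j - e).
Proof.
move=> s0 je ej; rewrite exprVn mulrC; apply: (mulIf (expf_neq0 (e - j) s0)).
by rewrite divfK ?expf_neq0 // -exprD; congr (_ ^+ _); lia.
Qed.

Lemma entryE n (w : 'M[k]_(n, dimV d)) a t :
  w a t = (form (row a w) (tagnat.sig1 t))`_(tagnat.sig2 t).
Proof. by rewrite coef_form /coord tagnat.sig2K mxE. Qed.

(** After [nilat_actf] only coordinates of positive weight survive, so [phi] along the torus orbit
    is polynomial in [s]. It equals [phi w] at [s] = 1, 2, 3, ..., hence at [s = 0], where it is
    [phi 0]. The map [iota] covers tuples and single vectors at once. *)
Lemma nilat_meval n N (F : {mpoly k[N]}) (iota : 'I_N -> 'I_n * 'I_(dimV d))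
    (phi : 'M[k]_(n, dimV d) -> k) w q :
  (forall w, phi w = F.@[fun t => w (iota t).1 (iota t).2]) ->
  (forall g w, SL2 g -> phi (w *m rhoV d g) = phi w) ->
  (forall a i, nilat (d i) q (form (row a w) i)) -> phi w = phi 0.
Proof.
move=> phiE phi_inv nw; have [g g1 gq] := nilat_actf q.
pose w1 := w *m rhoV d g.
(* Truncated subtraction gives 0 for a nonpositive weight, but then the coordinate is 0 by
   [w1_0]. *)
pose wt (t : 'I_(dimV d)) : nat := (2 * tagnat.sig2 t - d (tagnat.sig1 t))%N.
have lt2 t : (tagnat.sig2 (p_ := fun i => (d i).+1) t <= d (tagnat.sig1 t))%N.
  by rewrite -ltnS ltn_ord.
have w1_0 a t : (2 * tagnat.sig2 t <= d (tagnat.sig1 t))%N -> w1 a t = 0.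
  by move=> h; rewrite entryE row_mul form_act gq ?size_form.
pose h t : {poly k} := (w1 (iota t).1 (iota t).2)%:P * 'X^(wt (iota t).2).
pose P := mmap polyC h F - (phi w)%:P.
have P0 : P = 0.
  apply: (poly_eq0_nat hk) => l; set s : k := l.+1%:R.
  have s0 : s != 0 by rewrite char0_natr_eq0.
  rewrite hornerD hornerN hornerC horner_mmap.
  apply/eqP; rewrite subr_eq0; apply/eqP.
  rewrite -(phi_inv _ _ g1) -(phi_inv (mx2 s^-1 0 0 s)); last first.
    by apply: SL2_mx2; rewrite mulVf // mul0r subr0.
  rewrite phiE; apply: meval_eq => t /=; rewrite hornerM hornerC hornerXn -/w1.
  set a := (iota t).1; set t' := (iota t).2.
  rewrite [RHS]entryE row_mul form_act coef_actf_torus ?lt2 // -entryE.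
  have [le2|lt2'] := leqP (2 * tagnat.sig2 t') (d (tagnat.sig1 t')).
    by rewrite w1_0 ?mul0r.
  by rewrite torus_weight // ltnW.
have := congr1 (fun p => p.[0]) P0; rewrite /P hornerD hornerN hornerC horner0 horner_mmap.
move/eqP; rewrite subr_eq0 => /eqP <-; rewrite phiE; apply: meval_eq => t.
rewrite hornerM hornerC hornerXn [RHS]mxE expr0n /wt subn_eq0; case: leqP => [le2|_].
  by rewrite w1_0 ?mul0r.
by rewrite mulr0.
Qed.

End DestabilizingTorus.

(** * Polarizations and the two cones *)

Lemma rmorph_mmap (R S T : comNzRingType) n (E : {rmorphism S -> T}) (f : R -> S)
    (h : 'I_n -> S) (p : {mpoly R[n]}) :
  E (mmap f h p) = mmap (E \o f) (E \o h) p.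
Proof.
rewrite /mmap rmorph_sum; apply: eq_bigr => mu _; rewrite rmorphM /mmap1 rmorph_prod.
by congr (_ * _); apply: eq_bigr => i _; rewrite rmorphXn.
Qed.

Section NullCones.
Variables (k : fieldType) (m : nat) (d : 'I_m -> nat).
Hypothesis hk : [pchar k] =i pred0.

Lemma mxvec_coord (n N : nat) : exists iota : 'I_(n * N) -> 'I_n * 'I_N,
  forall (w : 'M[k]_(n, N)) t, mxvec w 0 t = w (iota t).1 (iota t).2.
Proof.
exists (fun t => enum_val (cast_ord (esym (mxvec_cast n N)) t)) => w t.
by rewrite /mxvec castmxE !mxE.
Qed.

Lemma nilat_nullcone n (w : 'M[k]_(n, dimV d)) q :
  (forall a i, nilat (d i) q (form (row a w) i)) -> nullcone w.
Proof.
move=> nw F Finv; have [iota Hiota] := mxvec_coord n (dimV d).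
apply: (@nilat_meval k m d hk n _ F iota (@evalVn k m d n F) w q) => // w'.
by apply: meval_eq => t; rewrite Hiota.
Qed.

Lemma nilat_unstable (v : 'rV[k]_(dimV d)) q :
  (forall i, nilat (d i) q (form v i)) -> unstable v.
Proof.
move=> nv f finv.
apply: (@nilat_meval k m d hk 1 _ f (fun t => (0, t))
          (fun v : 'rV[k]_(dimV d) => f.@[fun t => v 0 t]) v q) => // a i.
by rewrite row_id.
Qed.

Definition polval n (f : {mpoly k[dimV d]}) (w : 'M[k]_(n, dimV d)) : {mpoly k[n]} :=
  map_mpoly (meval (fun t => mxvec w 0 t)) (@polarize_all k m d n f).

Lemma polvalE n f (w : 'M[k]_(n, dimV d)) (a : 'rV[k]_n) :
  (polval f w).@[fun i => a 0 i] = f.@[fun j => (a *m w) 0 j].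
Proof.
rewrite /polval /polarize_all.
rewrite (rmorph_mmap (map_mpoly (meval (fun t => mxvec w 0 t)))).
rewrite (rmorph_mmap (meval (fun i => a 0 i))) [RHS]mevalE /mmap; apply: eq_bigr => mu _.
rewrite /= map_mpolyC !mevalC; congr (_ * _); first by rewrite /= mevalC.
rewrite /mmap1; apply: eq_bigr => j _ /=; congr (_ ^+ _); rewrite mxE.
rewrite (rmorph_sum (map_mpoly (meval (fun t => mxvec w 0 t)))) rmorph_sum /=.
apply: eq_bigr => i _; rewrite !rmorphM /= map_mpolyX map_mpolyC /= mevalC !mevalXU.
by rewrite mxvecE.
Qed.

Lemma mcoeff_polval n f (w : 'M[k]_(n, dimV d)) mu :
  (polval f w)@_mu = evalVn (polarization f mu) w.
Proof. by rewrite mcoeff_map_mpoly. Qed.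

(** Over an infinite field values determine coefficients, so the polarizations at [w] depend only on
    [f] on the span of the rows. *)
Lemma polval_ext n f (w w' : 'M[k]_(n, dimV d)) :
  (forall a : 'rV[k]_n, f.@[fun j => (a *m w) 0 j] = f.@[fun j => (a *m w') 0 j]) ->
  polval f w = polval f w'.
Proof.
move=> eqf; apply: (mpoly_ext hk) => x.
have E (w0 : 'M[k]_(n, dimV d)) : (polval f w0).@[x] = (polval f w0).@[fun i => (\row_i x i) 0 i].
  by apply: meval_eq => i; rewrite mxE.
by rewrite E [RHS]E !polvalE.
Qed.

Lemma evalVn_polarization n f mu (w w' : 'M[k]_(n, dimV d)) :
  (forall a : 'rV[k]_n, f.@[fun j => (a *m w) 0 j] = f.@[fun j => (a *m w') 0 j]) ->
  evalVn (polarization f mu) w = evalVn (polarization f mu) w'.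
Proof. by move=> /polval_ext E; rewrite -!mcoeff_polval E. Qed.

Lemma pol_alg_eq n (w w' : 'M[k]_(n, dimV d)) :
  (forall (a : 'rV[k]_n) f, Defs.invariant f ->
     f.@[fun j => (a *m w) 0 j] = f.@[fun j => (a *m w') 0 j]) ->
  forall h, pol_alg h -> evalVn h w = evalVn h w'.
Proof.
move=> eqw h; elim=> [f mu finv|c|p q _ IHp _ IHq|p q _ IHp _ IHq].
- by apply: evalVn_polarization => a; apply: eqw.
- by rewrite /evalVn !mevalC.
- by rewrite /evalVn !mevalD -!/(evalVn _ _) IHp IHq.
- by rewrite /evalVn !mevalM -!/(evalVn _ _) IHp IHq.
Qed.

(** Polarized invariants are invariant: [g] acts on every combination of the rows by right
    multiplication. *)
Lemma nullcone_polcone n (w : 'M[k]_(n, dimV d)) : nullcone w -> polcone w.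
Proof.
move=> nw h ph; apply: nw => g w' g1; apply: pol_alg_eq ph => a f finv.
by rewrite mulmxA finv.
Qed.

(** With the converse [unstable_polcone], the polarization cone consists of the tuples whose row
    span lies in the null cone of [V]. *)
Lemma polcone_unstable n (w : 'M[k]_(n, dimV d)) (a : 'rV[k]_n) :
  polcone w -> unstable (a *m w).
Proof.
move=> pw f finv.
have E : polval f w = polval f 0.
  by apply/mpolyP => mu; rewrite !mcoeff_polval; apply: pw; apply: pol_alg_gen.
by rewrite -polvalE E polvalE mulmx0.
Qed.

Lemma unstable_polcone n (w : 'M[k]_(n, dimV d)) :
  (forall a : 'rV[k]_n, unstable (a *m w)) -> polcone w.
Proof.
move=> uw h; apply: pol_alg_eq => a f finv.
by rewrite mulmx0; apply: uw.
Qed.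

End NullCones.

(** * The common point of a space of nilpotent forms *)

Section CommonPoint.
Variable k : closedFieldType.
Hypothesis hk : [pchar k] =i pred0.

(** From degree 2 on, [z] is a double root of [p + t *: r], and the Wronskian of this form with [r]
    is that of [p] with [r]. *)
Lemma double_root_wronskian d (p r : {poly k}) (z t : k) : (1 < d)%N ->
  nilat d (Some z) (p + t *: r) -> root (p * r^`() - p^`() * r) z.
Proof.
move=> d1 /= /(dvdp_trans (dvdp_exp2l ('X - z%:P) (_ : 2 <= d./2.+1)%N)) => H.
have /dvdpP[u Du] : ('X - z%:P) ^+ 2 %| p + t *: r by apply: H; lia.
have -> : p = u * ('X - z%:P) ^+ 2 - t *: r by rewrite -Du addrK.
apply/rootP; rewrite derivB derivZ expr2 !derivM derivXsubC.
rewrite !(hornerD, hornerN, hornerM, hornerZ, hornerX, hornerC); ring.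
Qed.

(* The points q_n of a + n b, n a natural number, are infinite or roots of the
   Wronskian of a and b. If it is nonzero, two of them coincide. *)
Lemma common_nilat2 m (d : 'I_m -> nat) (a b : 'rV[k]_(dimV d)) i0 q0 :
  (forall i, d i <> 1%N) -> form a i0 != 0 ->
  (forall t, exists q, forall i, nilat (d i) q (form (a + t *: b) i)) ->
  (forall i, nilat (d i) q0 (form a i)) -> forall i, nilat (d i) q0 (form b i).
Proof.
move=> d1 a0 hab ha.
have from_t t : t != 0 -> (forall i, nilat (d i) q0 (form (a + t *: b) i)) ->
    forall i, nilat (d i) q0 (form b i).
  move=> t0 ht i; have -> : b = t^-1 *: ((a + t *: b) + (-1) *: a).
    by rewrite scaleN1r addrAC subrr add0r scalerA mulVf // scale1r.
  by rewrite formZ formD formZ; apply/nilatZ/nilatD; rewrite ?nilatZ.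
set p := form a i0 in a0 *; pose r := form b i0.
(* If the Wronskian is 0, component [i0] of [a + t *: b] is [1 + t * c] times that of [a]. With [t]
   = 1, or 2 if [c = -1], it is nonzero, so its point is [q0]. *)
have [W0|W0] := eqVneq (p * r^`() - p^`() * r) 0.
  have [c Dc] := wronskian_eq0 hk a0 (subr0_eq W0).
  have [t t0 tc] : exists2 t, t != 0 & 1 + t * c != 0.
    have [c1|c1] := eqVneq (1 + c) 0; last by exists 1; rewrite ?oner_neq0 ?mul1r.
    exists 2%:R; first by rewrite char0_natr_eq0.
    have -> : c = -1 by apply/eqP; rewrite -addr_eq0 addrC c1.
    by rewrite mulrN1 -{1}[1]/(1%:R) -opprB oppr_eq0 -natrB // char0_natr_eq0.
  have [q hq] := hab t.
  suff Dq : q0 = q by apply: (from_t t t0); rewrite Dq.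
  apply: (nilat_uniq (size_form a i0) a0 (ha i0)).
  have := hq i0; rewrite formD formZ -/p -/r Dc scalerA -{1}[p]scale1r -scalerDl.
  by move/(nilatZ (1 + t * c)^-1); rewrite scalerA mulVf // scale1r.
have di0 : (1 < d i0)%N.
  have := d1 i0; have := ha i0; have := size_form a i0; rewrite -/p.
  case: (d i0) => [|[|//]] //= sp np _; case/eqP: a0; apply/eqP.
  case: (q0) np => [z|] /=; last by rewrite leqn0 size_poly_eq0.
  rewrite expr1 => np; apply/negPn/negP => p0; have := dvdp_leq p0 np.
  by rewrite size_XsubC => /leq_trans/(_ sp).
have hex n : exists q, [forall i, nilat (d i) q (form (a + n%:R *: b) i)].
  by have [q hq] := hab n%:R; exists q; apply/forallP.
pose qn n := xchoose (hex n).
have qnP n i : nilat (d i) (qn n) (form (a + n%:R *: b) i).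
  by have /forallP/(_ i) := xchooseP (hex n).
have [rs Drs] := closed_field_poly_normal (p * r^`() - p^`() * r).
set W := p * _ - _ in W0 Drs.
have qn_in n : qn n \in None :: map Some rs.
  have := qnP n i0; rewrite formD formZ -/p -/r; case: (qn n) => [z|] // np.
  rewrite inE /= mem_map; last by move=> ? ? [].
  have := double_root_wronskian di0 np; rewrite -/W Drs rootZ ?lead_coef_eq0 //.
  by rewrite root_prod_XsubC.
(* Pigeonhole: [(size rs).+2] values of [n] against [(size rs).+1] possible points, infinity
   included. *)
have /(uniqPn None)[x [y [xy ysz]]] : ~~ uniq [seq qn n | n <- iota 0 (size rs).+2].
  apply/negP => /uniq_leq_size H.
  have : (size [seq qn n | n <- iota 0 (size rs).+2] <= size (None :: map Some rs))%N.
    by apply: H => _ /mapP[n _ ->].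
  by rewrite size_map size_iota /= size_map ltnn.
rewrite size_map size_iota in ysz; have xsz := ltn_trans xy ysz.
rewrite !(nth_map 0%N) ?size_iota // !nth_iota // !add0n => qxy.
have nb i : nilat (d i) (qn x) (form b i).
  have -> : b = (y - x)%:R^-1 *: ((a + y%:R *: b) + (-1) *: (a + x%:R *: b)).
    rewrite scaleN1r opprD addrACA subrr add0r -scalerBl -natrB ?(ltnW xy) // scalerA.
    by rewrite mulVf ?scale1r // char0_natr_eq0 // subn_eq0 -ltnNge.
  by rewrite formZ formD [form (-1 *: _) _]formZ; apply/nilatZ/nilatD; rewrite ?nilatZ // qxy.
have na i : nilat (d i) (qn x) (form a i).
  have -> : a = (a + x%:R *: b) + (- x%:R) *: b by rewrite scaleNr addrK.
  by rewrite formD [form (- _ *: _) _]formZ; apply: nilatD; rewrite ?nilatZ.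
by rewrite (nilat_uniq (size_form a i0) a0 (ha i0) (na i0)).
Qed.

(** A row with a nonzero component fixes the point; the pencils through this row carry it to every
    other row. *)
Lemma common_nilat m (d : 'I_m -> nat) n (w : 'M[k]_(n, dimV d)) :
  (forall i, d i <> 1%N) ->
  (forall a : 'rV[k]_n, exists q, forall i, nilat (d i) q (form (a *m w) i)) ->
  exists q, forall a i, nilat (d i) q (form (row a w) i).
Proof.
move=> d1 hw; case: (pickP (fun x : 'I_n * 'I_m => form (row x.1 w) x.2 != 0)).
  move=> [a0 i0] /= f0; have [q hq] := hw (delta_mx 0 a0); rewrite -rowE in hq.
  exists q => a; apply: (common_nilat2 d1 f0) => // t.
  by have [q' hq'] := hw (delta_mx 0 a0 + t *: delta_mx 0 a);
    exists q'; rewrite mulmxDl -scalemxAl -!rowE in hq'.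
by move=> h; exists None => a i; rewrite (eqP (negbFE (h (a, i)))) nilat0.
Qed.

End CommonPoint.

(** * Failure for pairs when a linear summand is present *)

Section LinearSummand.
Variables (k : closedFieldType) (m : nat) (d : 'I_m -> nat) (i0 : 'I_m).
Hypothesis hk : [pchar k] =i pred0.
Hypothesis di0 : d i0 = 1%N.

Let c0 : 'I_(dimV d) := coord (ord0 : 'I_(d i0).+1).
Let c1 : 'I_(dimV d) := coord (ord_max : 'I_(d i0).+1).

Definition lpair (v : 'rV[k]_(dimV d)) : k * k := (v 0 c0, v 0 c1).

Lemma form_lpair v : form v i0 = lform (lpair v).
Proof.
have := size_form v i0; rewrite di0 => sv; rewrite [LHS](poly_sumE sv).
rewrite !big_ord_recl big_ord0 addr0 /= /lform /= -(coef_form v (ord0 : 'I_(d i0).+1)).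
by rewrite -(coef_form v (ord_max : 'I_(d i0).+1)) /= di0 expr0 alg_polyC.
Qed.

Lemma lform_inj : injective (@lform k).
Proof.
move=> [a b] [a' b'] /polyP E; have := E 0%N; have := E 1%N.
by rewrite /lform !coefD !coefZ !coefC !coefX /= !(mulr0, mulr1, addr0, add0r) => -> ->.
Qed.

Lemma lpair_act g v : lpair (v *m rhoV d g) = lact g (lpair v).
Proof.
by apply: lform_inj; rewrite -form_lpair form_act di0 form_lpair actf_lform.
Qed.

Lemma not_cones_agree n : (1 < n)%N -> ~ cones_agree k d n.
Proof.
move=> n1 agree; have n0 : (0 < n)%N by apply: ltnW.
pose a0 := Ordinal n0; pose a1 := Ordinal n1.
have c01 : c0 != c1.
  apply/eqP => /tagnat.rank_inj/eqP; rewrite eq_Tagged /= -val_eqE /= di0.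
  by [].
(* Rows [a0] and [a1] are the linear forms x and y, all else is 0; their bracket [F] has value 1 at
   [w]. *)
pose w : 'M[k]_(n, dimV d) := delta_mx a0 c0 + delta_mx a1 c1.
pose F : {mpoly k[n * dimV d]} :=
  'X_(mxvec_index a0 c0) * 'X_(mxvec_index a1 c1) -
  'X_(mxvec_index a0 c1) * 'X_(mxvec_index a1 c0).
have FE w' : evalVn F w' = br (lpair (row a0 w')) (lpair (row a1 w')).
  by rewrite /evalVn mevalB !mevalM !mevalXU !mxvecE /br /= !mxE.
have pw : polcone w.
  apply: (unstable_polcone hk) => a; set v := a *m w.
  have v_off i : i != i0 -> form v i = 0.
    move=> ne; apply/polyP => j; rewrite coef0.
    have [lt_j|le_j] := ltnP j (d i).+1; last by rewrite nth_default ?(leq_trans (size_form v i)).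
    pose u : 'I_(d i).+1 := Ordinal lt_j.
    have off (j0 : 'I_(d i0).+1) : coord u != coord j0.
      by apply/eqP => /tagnat.rank_inj/(congr1 (@tag _ _))/= Di; rewrite Di eqxx in ne.
    rewrite (coef_form v u) mxE big1 // => b _.
    by rewrite !mxE (negPf (off ord0)) (negPf (off ord_max)) !andbF addr0 mulr0.
  (* A linear form is nilpotent: at infinity if it is constant, since [uphalf 1 = 1], and otherwise
     at its root. *)
  have [q nq] : exists q, nilat 1 q (form v i0).
    have := size_form v i0; rewrite di0 => sv.
    have [s1|s2] := leqP (size (form v i0)) 1; first by exists None.
    have /closed_rootP[z hz] : size (form v i0) != 1%N by rewrite neq_ltn s2 orbT.
    by exists (Some z); rewrite /= expr1 dvdp_XsubCl.
  apply: (@nilat_unstable _ _ _ hk _ q) => i.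
  by have [->|ne] := eqVneq i i0; [rewrite di0 | rewrite v_off // nilat0].
have Finv : invariantn F by move=> g w' g1; rewrite !FE !row_mul !lpair_act br_lact g1 mul1r.
have := proj2 (agree w) pw F Finv; rewrite !FE /br /lpair /= !mxE.
have a01 : (a0 == a1) = false by [].
rewrite !eqxx [a1 == a0]eq_sym a01 [c1 == c0]eq_sym (negPf c01) /=.
by rewrite !(mulr0, mul0r, addr0, add0r, mulr1) oppr0 addr0; apply/eqP/oner_neq0.
Qed.

End LinearSummand.

(** * The polarization index *)

Lemma cones_agreeP (k : closedFieldType) (m : nat) (d : 'I_m -> nat) n :
  [pchar k] =i pred0 -> (forall i, d i <> 1%N) \/ (n <= 1)%N -> cones_agree k d n.
Proof.
move=> hk hd w; split; first exact: nullcone_polcone.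
move=> pw; have hq (a : 'rV[k]_n) : exists q, forall i, nilat (d i) q (form (a *m w) i).
  by apply: unstable_nilat => //; apply: polcone_unstable.
suff [q hw] : exists q, forall a i, nilat (d i) q (form (row a w) i).
  exact: nilat_nullcone hw.
case: hd => [d1|n1]; first exact: common_nilat.
(* A single row is itself a combination, so its own point serves; for [n = 0] there are no rows. *)
case: n n1 w pw hq => [|[|//]] _ w pw hq; first by exists None => -[].
by have [q hw] := hq 1%:M; exists q => a i; rewrite [a]ord1 row_id -[w]mul1mx.
Qed.

Theorem theorem3p15 (k : closedFieldType) (hk : [pchar k] =i pred0)
  (m : nat) (d : 'I_m -> nat) :
  ((exists i : 'I_m, d i = 1%N) -> pol_ind_is k d (Some 1%N)) /\
  ((forall i : 'I_m, d i <> 1%N) -> pol_ind_is k d None).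
Proof.
split=> [[i0 di0]|d1].
  split=> [n|q Hq]; last by apply/Hq/cones_agreeP; [|right].
  by rewrite leqNgt => agree; apply/negP => n1; apply: (not_cones_agree hk di0 n1 agree).
move=> q Hq; have := Hq q.+1 (cones_agreeP hk (or_introl d1)).
by rewrite ltnn.
Qed.
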